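(* Let $R$ be a ring with unity and let $G$ be an exact complex of left $R$-modules. Then the following statements are equivalent: (1) $G$ is strongly Cartan-Eilenberg Gorenstein projective. (2) $G_n$ is a projective left $R$-module for each $n\in\mathbb{Z}$, and the complex $\mathrm{Hom}_R(G,P)$ is exact for every Cartan-Eilenberg projective complex $P$.
   Context: Complexes are complexes of left $R$-modules, graded homologically ($\delta_n:C_n\to C_{n-1}$), with $\mathrm{Z}_n(C)=\mathrm{Ker}(\delta_n)$, $\mathrm{B}_n(C)=\mathrm{Im}(\delta_{n+1})$, $\mathrm{H}_n(C)=\mathrm{Z}_n(C)/\mathrm{B}_n(C)$. $\mathrm{Hom}(C,D)$ is the abelian group of chain maps $C\to D$. $\mathrm{Hom}_R(C,D)$ is the complex of abelian groups with $\mathrm{Hom}_R(C,D)_n=\prod_{t\in\mathbb{Z}}\mathrm{Hom}_R(C_t,D_{n+t})$ and differential $(\delta_n f)_m=\delta^D_{m+n}f_m-(-1)^nf_{m-1}\delta^C_m$. $\mathrm{Z}(C)$, $\mathrm{B}(C)$, $\mathrm{H}(C)$, $C/\mathrm{Z}(C)$, $C/\mathrm{B}(C)$ denote the complexes with components $\mathrm{Z}_n(C)$, $\mathrm{B}_n(C)$, $\mathrm{H}_n(C)$, $C_n/\mathrm{Z}_n(C)$, $C_n/\mathrm{B}_n(C)$. A complex $P$ is C-E (Cartan-Eilenberg) projective if $P_n$, $\mathrm{Z}_n(P)$, $\mathrm{B}_n(P)$ and $\mathrm{H}_n(P)$ are projective modules for all $n\in\mathbb{Z}$. A sequence of complexes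 $\cdots\to C^{-1}\to C^0\to C^1\to\cdots$ is C-E exact if it is exact and the induced sequences of $\mathrm{Z}(C^i)$, of $\mathrm{B}(C^i)$, of $C^i/\mathrm{Z}(C^i)$, of $C^i/\mathrm{B}(C^i)$ and of $\mathrm{H}(C^i)$ are all exact. It is strongly C-E exact if it is C-E exact and degreewise split, i.e. for every $n$ the exact sequence of modules $\cdots\to C^{-1}_n\to C^0_n\to C^1_n\to\cdots$ is split (each of the short exact sequences into which it decomposes splits). A complex $G$ is strongly C-E (Cartan-Eilenberg) Gorenstein projective if there is a strongly C-E exact sequence of C-E projective complexes $\mathbb{P}:\cdots\to P^{-1}\to P^0\to P^1\to\cdots$ with $G\cong\mathrm{Ker}(P^0\to P^1)$ such that $\mathrm{Hom}(-,Q)$ leaves $\mathbb{P}$ exact for every C-E projective complex $Q$. *)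

(* Defs.v *)
From HB Require Import structures.
From mathcomp Require Import all_boot all_order all_algebra.
From mathcomp Require Import boolp.

Set Implicit Arguments.
Unset Strict Implicit.
Unset Printing Implicit Defensive.

Import GRing.Theory.
Local Open Scope ring_scope.
Local Open Scope quotient_scope.

(* MathComp has neither products of infinite families of abelian groups nor
   a group structure on linear maps; both are put on named aliases so that they
   do not interfere with the instances MathComp-Analysis attaches to arrows. *)

Definition dprod (I : Type) (M : I -> zmodType) : Type := forall i, M i.

Section DProd.
Variables (I : Type) (M : I -> zmodType).
Local Notation T := (dprod M).

HB.instance Definition _ := gen_eqMixin T.
HB.instance Definition _ := gen_choiceMixin T.

Let zero : T := fun i => 0.
Let opp (f : T) : T := fun i => - f i.
Let add (f g : T) : T := fun i => f i + g i.

Fact dprod_addA : associative add.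
Proof. by move=> f g h; apply: functional_extensionality_dep => i; exact: addrA. Qed.
Fact dprod_addC : commutative add.
Proof. by move=> f g; apply: functional_extensionality_dep => i; exact: addrC. Qed.
Fact dprod_add0 : left_id zero add.
Proof. by move=> f; apply: functional_extensionality_dep => i; exact: add0r. Qed.
Fact dprod_addN : left_inverse zero opp add.
Proof. by move=> f; apply: functional_extensionality_dep => i; exact: addNr. Qed.

HB.instance Definition _ :=
  GRing.isZmodule.Build T dprod_addA dprod_addC dprod_add0 dprod_addN.
End DProd.

Definition Hom (R : pzRingType) (U V : lmodType R) : Type := {linear U -> V}.

Lemma Hom_ext (R : pzRingType) (U V : lmodType R) (f g : {linear U -> V}) :
  f =1 g -> f = g.
Proof.
move=> fg; case: f g fg => f [[f1] [f2]] [g [[g1] [g2]]] /= /funext fg.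
by case: g / fg g1 g2 => g1 g2; rewrite (Prop_irrelevance f1 g1) (Prop_irrelevance f2 g2).
Qed.

Section HomGroup.
Variables (R : pzRingType) (U V : lmodType R).
Local Notation T := (Hom U V).

HB.instance Definition _ := gen_eqMixin T.
HB.instance Definition _ := gen_choiceMixin T.

Let zero : T := (\0 : U -> V).
Let opp (f : T) : T := \- f.
Let add (f g : T) : T := f \+ g.

Fact Hom_addA : associative add.
Proof. by move=> f g h; apply: Hom_ext => x; exact: addrA. Qed.
Fact Hom_addC : commutative add.
Proof. by move=> f g; apply: Hom_ext => x; exact: addrC. Qed.
Fact Hom_add0 : left_id zero add.
Proof. by move=> f; apply: Hom_ext => x; exact: add0r. Qed.
Fact Hom_addN : left_inverse zero opp add.
Proof. by move=> f; apply: Hom_ext => x; exact: addNr. Qed.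

HB.instance Definition _ :=
  GRing.isZmodule.Build T Hom_addA Hom_addC Hom_add0 Hom_addN.
End HomGroup.

Section SubQuotients.
Variable R : pzRingType.
Implicit Types U V W : lmodType R.

Record submod V (S : submodClosed V) :=
  Submod { submod_val :> V; _ : submod_val \in (S : {pred V}) }.

HB.instance Definition _ V (S : submodClosed V) :=
  [isSub for @submod_val V S].
HB.instance Definition _ V (S : submodClosed V) :=
  [Choice of submod S by <:].
HB.instance Definition _ V (S : submodClosed V) :=
  [SubChoice_isSubLmodule of submod S by <:].

Section Quotient.
Variables (V : lmodType R) (S : submodClosed V).

Definition zpred : {pred V} := S.
Fact zpred_closed : zmod_closed zpred.
Proof. exact: (submodClosedP S : zmod_closed S). Qed.
HB.instance Definition _ := GRing.isZmodClosed.Build V zpred zpred_closed.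

Definition quomod : Type := Quotient.quot zpred.
HB.instance Definition _ := GRing.Zmodule.on quomod.
HB.instance Definition _ := EqQuotient.on quomod.

Let scale (a : R) (x : quomod) : quomod := \pi_quomod (a *: repr x).

Lemma quomod_eqP (x y : V) :
  reflect (\pi_quomod x = \pi_quomod y) (x - y \in (S : {pred V})).
Proof.
rewrite -[_ \in _]/(x - y \in zpred).
by rewrite (Quotient.idealrBE zpred); apply: eqP.
Qed.

Lemma quomod_piD (x y : V) : \pi_quomod (x + y) = \pi_quomod x + \pi_quomod y.
Proof. by rewrite -[LHS]/(\pi_(Quotient.quot zpred) (x + y)) Quotient.pi_add. Qed.

Fact quomod_scaleE a (x : V) : scale a (\pi_quomod x) = \pi_quomod (a *: x).
Proof.
apply/quomod_eqP; rewrite -scalerBr.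
by apply: rpredZ; apply/quomod_eqP; rewrite reprK.
Qed.

Fact quomod_scaleA a b (x : quomod) : scale a (scale b x) = scale (a * b) x.
Proof.
by rewrite -[x]reprK [scale b _]quomod_scaleE [LHS]quomod_scaleE [RHS]quomod_scaleE scalerA.
Qed.
Fact quomod_scale1 : left_id 1 scale.
Proof. by move=> x; rewrite -[x]reprK [LHS]quomod_scaleE scale1r. Qed.
Fact quomod_scaleDr : right_distributive scale +%R.
Proof.
move=> a x y; rewrite -[x]reprK -[y]reprK -quomod_piD [LHS]quomod_scaleE.
rewrite [scale a (\pi_quomod (repr x))]quomod_scaleE [scale a (\pi_quomod (repr y))]quomod_scaleE.
by rewrite -quomod_piD scalerDr.
Qed.
Fact quomod_scaleDl (x : quomod) : {morph scale^~ x : a b / a + b}.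
Proof.
move=> a b /=; rewrite -[x]reprK [LHS]quomod_scaleE.
rewrite [scale a _]quomod_scaleE [scale b _]quomod_scaleE.
by rewrite -quomod_piD scalerDl.
Qed.
HB.instance Definition _ := GRing.Zmodule_isLmodule.Build R quomod
  quomod_scaleA quomod_scale1 quomod_scaleDr quomod_scaleDl.

Definition quo_pi (x : V) : quomod := \pi_quomod x.
Fact quo_pi_linear : linear quo_pi.
Proof.
move=> a x y; rewrite /quo_pi quomod_piD; congr (_ + _).
by rewrite -quomod_scaleE.
Qed.
HB.instance Definition _ :=
  GRing.isLinear.Build R V quomod *:%R quo_pi quo_pi_linear.

End Quotient.

Definition ker_pred U V (f : {linear U -> V}) : {pred U} := [pred x | f x == 0].
Fact ker_pred_closed U V (f : {linear U -> V}) : submod_closed (ker_pred f).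
Proof.
split=> [|a x y]; rewrite !inE ?linear0 // => /eqP fx /eqP fy.
by rewrite linearP fx fy scaler0 addr0.
Qed.
HB.instance Definition _ U V (f : {linear U -> V}) :=
  GRing.isSubmodClosed.Build R U (ker_pred f) (ker_pred_closed f).

Definition im_pred U V (f : {linear U -> V}) : {pred V} :=
  [pred y | `[< exists x, f x = y >]].
Fact im_pred_closed U V (f : {linear U -> V}) : submod_closed (im_pred f).
Proof.
split=> [|a x y]; rewrite !inE; first by apply/asboolP; exists 0; exact: linear0.
move=> /asboolP[u <-] /asboolP[v <-].
by apply/asboolP; exists (a *: u + v); exact: linearP.
Qed.
HB.instance Definition _ U V (f : {linear U -> V}) :=
  GRing.isSubmodClosed.Build R V (im_pred f) (im_pred_closed f).

Definition preim_pred U V (f : {linear U -> V}) (S : submodClosed V) : {pred U} :=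
  [pred x | f x \in (S : {pred V})].
Fact preim_pred_closed U V (f : {linear U -> V}) S : submod_closed (preim_pred f S).
Proof.
split=> [|a x y]; rewrite !inE ?linear0 ?rpred0 // => fx fy.
by rewrite linearP rpredD // rpredZ.
Qed.
HB.instance Definition _ U V (f : {linear U -> V}) S :=
  GRing.isSubmodClosed.Build R U (preim_pred f S) (preim_pred_closed f S).

Section InducedMaps.
Variables (U V : lmodType R) (f : {linear U -> V}).
Variables (S : submodClosed U) (T : submodClosed V).
Hypothesis fST : forall x, x \in (S : {pred U}) -> f x \in (T : {pred V}).

Definition sub_map (x : submod S) : submod T := Submod (fST (valP x)).
Fact sub_map_linear : linear sub_map.
Proof. by move=> a x y; apply: val_inj; rewrite /= linearP. Qed.
HB.instance Definition _ :=
  GRing.isLinear.Build R (submod S) (submod T) *:%R sub_map sub_map_linear.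

Definition quo_fun (x : quomod S) : quomod T := quo_pi T (f (repr x)).
Lemma quo_funE x : quo_fun (quo_pi S x) = quo_pi T (f x).
Proof.
apply/quomod_eqP; rewrite -raddfB; apply: fST.
by apply/quomod_eqP; rewrite reprK.
Qed.
Fact quo_fun_linear : linear quo_fun.
Proof.
move=> a x y; rewrite -[x]reprK -[y]reprK -!/(quo_pi S _).
by rewrite -linearP !quo_funE -linearP -linearP.
Qed.
Definition quo_map : {linear quomod S -> quomod T} :=
  HB.pack quo_fun
    (GRing.isLinear.Build R (quomod S) (quomod T) *:%R quo_fun quo_fun_linear).
Lemma quo_mapE x : quo_map (quo_pi S x) = quo_pi T (f x).
Proof. exact: quo_funE. Qed.
End InducedMaps.

End SubQuotients.

Definition projective (R : pzRingType) (P : lmodType R) : Prop :=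
  forall (M N : lmodType R) (g : {linear M -> N}) (f : {linear P -> N}),
    (forall y, exists x, g x = y) ->
    exists h : {linear P -> M}, forall x, g (h x) = f x.

Definition exact_at (U V W : zmodType) (f : U -> V) (g : V -> W) : Prop :=
  forall y, g y = 0 <-> exists x, f x = y.

(* A sequence M_i -> M_{i+1} (i in Z); as i ranges over Z, so does i + 1. *)
Definition exact_seq (M : int -> zmodType) (f : forall i, M i -> M (i + 1)) : Prop :=
  forall i, exact_at (f i) (f (i + 1)).

(* The differential is a family d i j : C_i -> C_j which vanishes unless
   i = j + 1, so that delta_n is d n (n - 1) and also d (n' + 1) n' for
   n = n' + 1, without casts along n - 1 + 1 = n. *)

Record abcomplex := AbComplex {
  abobj :> int -> zmodType;
  abd : forall i j, {additive abobj i -> abobj j};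
  abd_shape : forall i j x, i != j + 1 -> abd i j x = 0;
  abdK : forall i j k x, abd j k (abd i j x) = 0 }.

Record complex (R : pzRingType) := Complex {
  obj :> int -> lmodType R;
  d : forall i j, {linear obj i -> obj j};
  d_shape : forall i j x, i != j + 1 -> d i j x = 0;
  dK : forall i j k x, d j k (d i j x) = 0 }.

Arguments d {R} c i j.
Arguments dK {R} c i j k x.

Definition ab_of_complex (R : pzRingType) (C : complex R) : abcomplex :=
  @AbComplex (fun i => C i) (fun i j => d C i j) (@d_shape R C) (dK C).
Coercion ab_of_complex : complex >-> abcomplex.

Definition exact_complex (A : abcomplex) : Prop :=
  forall n, exact_at (abd A (n + 1) n) (abd A n (n - 1)).

Section ChainMaps.
Variables (R : pzRingType) (C D : complex R).

Definition chain_pred : {pred dprod (fun n => Hom (C n) (D n))} :=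
  [pred f : dprod (fun n => Hom (C n) (D n)) |
    `[< forall i j x, f j (d C i j x) = d D i j (f i x) >]].

Fact chain_pred_closed : zmod_closed chain_pred.
Proof.
split=> [|f g]; rewrite !inE.
  by apply/asboolP => i j x; rewrite [LHS]/= [X in d _ _ _ X]/= linear0.
move=> /asboolP Hf /asboolP Hg; apply/asboolP => i j x.
by rewrite [LHS](congr2 (fun u v => u - v) (Hf i j x) (Hg i j x)) -linearB.
Qed.
HB.instance Definition _ := GRing.isZmodClosed.Build _ chain_pred chain_pred_closed.

Record chain := Chain {
  chain_val : dprod (fun n => Hom (C n) (D n));
  _ : chain_val \in chain_pred }.
HB.instance Definition _ := [isSub for chain_val].
HB.instance Definition _ := [Choice of chain by <:].
HB.instance Definition _ := [SubChoice_isSubZmodule of chain by <:].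

Definition chain_fun (f : chain) : forall n, {linear C n -> D n} := chain_val f.
Coercion chain_fun : chain >-> Funclass.

Lemma chainP (f : chain) i j x : f j (d C i j x) = d D i j (f i x).
Proof. by case: f => f /= /asboolP; apply. Qed.
End ChainMaps.

Arguments chain_pred {R} C D _.

Section Precomposition.
Variables (R : pzRingType) (C D Q : complex R) (f : chain C D).

Fact precomp_chain (g : chain D Q) :
  ((fun n => g n \o f n) : dprod (fun n => Hom (C n) (Q n))) \in chain_pred C Q.
Proof. by apply/asboolP => i j x /=; rewrite !chainP. Qed.

Definition precomp (g : chain D Q) : chain C Q := Chain (precomp_chain g).
End Precomposition.

Definition iso_complex (R : pzRingType) (C D : complex R) : Prop :=
  exists (f : chain C D) (g : chain D C),
    forall n, cancel (f n) (g n) /\ cancel (g n) (f n).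

Section KernelComplex.
Variables (R : pzRingType) (C D : complex R) (f : chain C D).

Fact ker_complex_d i j x :
  x \in ker_pred (f i) -> d C i j x \in ker_pred (f j).
Proof. by rewrite !inE => /eqP fx; rewrite chainP fx linear0. Qed.

Definition ker_complex : complex R.
Proof.
refine (@Complex R (fun n => submod (ker_pred (f n)))
  (fun i j => sub_map (@ker_complex_d i j)) _ _).
- by move=> i j x ij; apply: val_inj; exact: d_shape.
- by move=> i j k x; apply: val_inj; exact: dK.
Defined.
End KernelComplex.

Section Subquotients.
Variables (R : pzRingType) (C : complex R) (n : int).

Definition Zpred := ker_pred (d C n (n - 1)).
Definition Bpred := im_pred (d C (n + 1) n).
HB.instance Definition _ := GRing.SubmodClosed.on Zpred.
HB.instance Definition _ := GRing.SubmodClosed.on Bpred.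

Definition Zmod : lmodType R := submod Zpred.
Definition Bmod : lmodType R := submod Bpred.
(* B_n(C) as a submodule of Z_n(C). *)
Definition BinZ := preim_pred (val : Zmod -> C n) Bpred.
HB.instance Definition _ := GRing.SubmodClosed.on BinZ.

Definition Hmod : lmodType R := quomod BinZ.
Definition CZmod : lmodType R := quomod Zpred.
Definition CBmod : lmodType R := quomod Bpred.
End Subquotients.

Arguments Zpred {R} C n _.
Arguments Bpred {R} C n _.
Arguments BinZ {R} C n _.

Section InducedSubquotientMaps.
Variables (R : pzRingType) (C D : complex R) (f : chain C D) (n : int).

Fact chain_Z x : x \in Zpred C n -> f n x \in Zpred D n.
Proof. by rewrite !inE => /eqP dx; rewrite -chainP dx linear0. Qed.
Fact chain_B x : x \in Bpred C n -> f n x \in Bpred D n.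
Proof.
by move=> /asboolP[y <-]; apply/asboolP; exists (f (n + 1) y); rewrite chainP.
Qed.

Definition Zmap : {linear Zmod C n -> Zmod D n} := sub_map chain_Z.
Definition Bmap : {linear Bmod C n -> Bmod D n} := sub_map chain_B.

Fact chain_H x : x \in BinZ C n -> Zmap x \in BinZ D n.
Proof. exact: chain_B. Qed.

Definition Hmap : {linear Hmod C n -> Hmod D n} := quo_map chain_H.
Definition CZmap : {linear CZmod C n -> CZmod D n} := quo_map chain_Z.
Definition CBmap : {linear CBmod C n -> CBmod D n} := quo_map chain_B.
End InducedSubquotientMaps.

Definition CE_projective (R : pzRingType) (P : complex R) : Prop :=
  forall n, [/\ projective (P n), projective (Zmod P n),
                projective (Bmod P n) & projective (Hmod P n)].

Record complex_seq (R : pzRingType) := ComplexSeq {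
  term :> int -> complex R;
  arrow : forall i, chain (term i) (term (i + 1)) }.

(* Exactness of a sequence of complexes is degreewise, so only the components of
   Z(C), B(C), C/Z(C), C/B(C) and H(C) matter. *)
Definition CE_exact (R : pzRingType) (X : complex_seq R) : Prop :=
  forall n,
    [/\ exact_seq (fun i => arrow X i n : X i n -> X (i + 1) n),
        exact_seq (fun i => Zmap (arrow X i) n),
        exact_seq (fun i => Bmap (arrow X i) n) &
        [/\ exact_seq (fun i => CZmap (arrow X i) n),
            exact_seq (fun i => CBmap (arrow X i) n) &
            exact_seq (fun i => Hmap (arrow X i) n)]].

(* For a term of an exact sequence, Im f is also the kernel of the next map.
   The short exact sequence 0 -> Ker f -> U -> Im f -> 0 splits. *)
Definition split_map (R : pzRingType) (U V : lmodType R) (f : {linear U -> V}) : Prop :=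
  exists s : {linear submod (im_pred f) -> U}, forall y, f (s y) = val y.

Definition strongly_CE_exact (R : pzRingType) (X : complex_seq R) : Prop :=
  CE_exact X /\ forall n i, split_map (arrow X i n).

Definition strongly_CE_Gorenstein_projective (R : pzRingType) (G : complex R) : Prop :=
  exists X : complex_seq R,
    [/\ strongly_CE_exact X,
        forall i, CE_projective (X i),
        iso_complex G (ker_complex (arrow X 0)) &
        forall Q : complex R, CE_projective Q ->
          forall i, exact_at (precomp (Q := Q) (arrow X (i + 1)))
                             (precomp (Q := Q) (arrow X i))].

Section HomComplex.
Variables (R : pzRingType).

(* The identity C_i -> C_j when i = j, and 0 otherwise. *)
Definition transport (C : int -> lmodType R) (i j : int) : {linear C i -> C j} :=
  match i =P j with
  | ReflectT e => match e in _ = k return {linear C i -> C k} with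
                  | erefl => (idfun : {linear C i -> C i})
                  end
  | ReflectF _ => (\0 : {linear C i -> C j})
  end.

Lemma transport_id (C : int -> lmodType R) i x : transport C i i x = x.
Proof.
by rewrite /transport; case: eqP => // e; rewrite (eq_axiomK e).
Qed.

Lemma transport_neq (C : int -> lmodType R) i j x :
  i != j -> transport C i j x = 0.
Proof. by rewrite /transport; case: eqP. Qed.

Variables (C D : complex R).

Definition homobj (n : int) : zmodType := dprod (fun t : int => Hom (C t) (D (n + t))).

(* For j = i - 1, the first term is delta^D_{i+m} f_m and the transport
   identifies D_{i+(m-1)}, where f_{m-1} delta^C_m x lives, with D_{j+m}; for
   other j both terms vanish. *)
Definition homd_fun (i j : int) (f : homobj i) (m : int) (x : C m) : D (j + m) :=
  d D (i + m) (j + m) (f m x)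
  - transport D (i + (m - 1)) (j + m) (f (m - 1) (d C m (m - 1) x)) *~ ((-1) ^ i).

Fact homd_fun_linear i j f m : linear (@homd_fun i j f m).
Proof.
move=> a x y; rewrite /homd_fun !linearP scalerBr mulrzDl opprD addrACA.
by rewrite scalerMzr.
Qed.
HB.instance Definition _ (i j : int) (f : homobj i) (m : int) :=
  GRing.isLinear.Build R (C m) (D (j + m)) *:%R (@homd_fun i j f m)
    (@homd_fun_linear i j f m).

Definition homd (i j : int) (f : homobj i) : homobj j := fun m => @homd_fun i j f m.

Fact homd_additive i j : zmod_morphism (@homd i j).
Proof.
move=> f g; apply: functional_extensionality_dep => m; apply: Hom_ext => x.
rewrite -[LHS]/(d D _ _ (f m x - g m x) -
  transport D _ _ (f (m - 1) (d C m (m - 1) x) - g (m - 1) (d C m (m - 1) x)) *~ _).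
by rewrite !linearB mulrzBl opprD addrACA -opprD.
Qed.
HB.instance Definition _ i j :=
  GRing.isZmodMorphism.Build (homobj i) (homobj j) (@homd i j) (@homd_additive i j).

Fact homd_shape i j (f : homobj i) : i != j + 1 -> homd j f = 0.
Proof.
move=> ij; apply: functional_extensionality_dep => m; apply: Hom_ext => x.
rewrite [LHS]/= /homd_fun d_shape; last first.
  by apply: contra_neq ij; rewrite addrAC => /addIr.
rewrite transport_neq ?mul0rz ?subrr //.
apply: contra_neq ij => /(congr1 (fun z => z - (m - 1))).
by rewrite addrK => ->; rewrite -addrA opprB (addrCA m) subrr addr0.
Qed.

Lemma transport_d i j k l x :
  i = j -> k = l -> d D j l (transport D i j x) = transport D k l (d D i k x).
Proof. by move=> <- <-; rewrite !transport_id. Qed.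

Fact homdK i j k (f : homobj i) : homd k (homd j f) = 0.
Proof.
have [ij|/homd_shape ->] := eqVneq i (j + 1); last exact: raddf0.
have [jk|/homd_shape -> //] := eqVneq j (k + 1).
apply: functional_extensionality_dep => m; apply: Hom_ext => x.
rewrite -[LHS]/(homd_fun k (homd j f) x) /homd_fun.
rewrite -![homd j f _ _]/(homd_fun j f _) /homd_fun.
rewrite !dK !linear0 mul0rz subr0 linearB dK sub0r raddfMz.
rewrite [X in - (X *~ _)](@transport_d _ _ (j + (m - 1)) _); first last.
- by rewrite jk -addrA subrKC.
- by rewrite ij -addrA subrKC.
have -> : (-1) ^ i = - ((-1) ^ j) :> int.
  by rewrite ij exprzDr // expr1z mulrN1.
by rewrite mulrNz opprK subrr.
Qed.

Definition hom_complex : abcomplex :=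
  @AbComplex homobj (fun i j => @homd i j) homd_shape homdK.
End HomComplex.

(* Main.v *)
(* Both conditions amount to: each G_n is projective, and every map G_n -> Q to a
   projective module which vanishes on B_n(G) factors through d : G_n -> G_(n-1).
   A C-E projective complex splits into zero-differential complexes and contractible
   ones, so this factorization property says that all chain maps of any degree from
   G to such a complex are null-homotopic. Given a resolution X with kernel G, it
   follows from exactness of Hom(X, Q) for Q with zero differential. Conversely, the
   degreewise split extensions 0 -> G -> cone(1_G) -> Sigma G -> 0 and their shifts
   splice into a sequence of contractible complexes with kernel G, for which
   exactness of Hom(-, Q) is again null-homotopy of the maps from shifts of G. *)

Require Import Defs.
From HB Require Import structures.
From mathcomp Require Import all_boot all_order all_algebra.
From mathcomp Require Import boolp zify.

Set Implicit Arguments.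
Unset Strict Implicit.
Unset Printing Implicit Defensive.

Import GRing.Theory.
Local Open Scope ring_scope.

(** * Linear maps and projective modules *)

Section Linear.
Variable R : pzRingType.
Implicit Types U V P Q : lmodType R.

Definition lin_of U V (f : U -> V) (fL : linear f) : {linear U -> V} :=
  HB.pack f (GRing.isLinear.Build R U V *:%R f fL).

Lemma linearMz U V (f : {linear U -> V}) (n : int) (x : U) : f (x *~ n) = f x *~ n.
Proof. exact: raddfMz. Qed.

Section Corestriction.
Variables (U V : lmodType R) (f : {linear U -> V}) (S : submodClosed V).
Hypothesis fS : forall x, f x \in (S : {pred V}).

Fact corestrict_linear : linear (fun x => Submod (fS x)).
Proof. by move=> a x y; apply: val_inj; rewrite /= linearP. Qed.
Definition corestrict : {linear U -> submod S} := lin_of corestrict_linear.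
End Corestriction.

Lemma projective_retract P Q (i : {linear Q -> P}) (r : {linear P -> Q}) :
  cancel i r -> projective P -> projective Q.
Proof.
move=> iK pP M N g f g_surj.
have [h hE] := pP M N g (f \o r) g_surj.
by exists (h \o i) => x; rewrite /= hE /= iK.
Qed.

Lemma projective_prod P Q : projective P -> projective Q -> projective (P * Q)%type.
Proof.
move=> pP pQ M N g f g_surj.
have il : linear (fun x : P => (x, 0 : Q)).
  by move=> a x y; congr (_, _); rewrite /= scaler0 addr0.
have ir : linear (fun y : Q => (0 : P, y)).
  by move=> a x y; congr (_, _); rewrite /= scaler0 addr0.
have [h hE] := pP M N g (f \o lin_of il) g_surj.
have [k kE] := pQ M N g (f \o lin_of ir) g_surj.
have hkL : linear (fun z : P * Q => h z.1 + k z.2).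
  by move=> a x y; rewrite /= !linearP scalerDr addrACA.
exists (lin_of hkL) => -[x y] /=; rewrite linearD hE kE /= -linearD.
by congr (f _); congr (_, _); rewrite /= ?addr0 ?add0r.
Qed.

Lemma projective_trivial P : (forall x : P, x = 0) -> projective P.
Proof.
by move=> P0 M N g f _; exists \0 => x; rewrite (P0 x) !linear0.
Qed.

Lemma projective_submod P (S : submodClosed P) (r : {linear P -> P}) :
  (forall x, r x \in (S : {pred P})) ->
  (forall x, x \in (S : {pred P}) -> r x = x) ->
  projective P -> projective (submod S).
Proof.
move=> rS rK.
apply: (projective_retract (i := (val : submod S -> P)) (r := corestrict rS)).
by move=> x; apply: val_inj; exact: rK (valP x).
Qed.

Lemma projective_quomod P (S : submodClosed P) :
  (forall x, x \in (S : {pred P}) -> x = 0) ->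
  projective P -> projective (quomod S).
Proof.
move=> S0; have piI : injective (quo_pi S).
  by move=> x y /quomod_eqP /S0 /eqP; rewrite subr_eq0 => /eqP.
have rK : cancel (repr : quomod S -> P) (quo_pi S) by move=> x; exact: reprK.
have rL : linear (repr : quomod S -> P).
  by move=> a x y; apply: piI; rewrite [LHS]rK linearP; congr (_ *: _ + _); rewrite [RHS]rK.
exact: (projective_retract (i := lin_of rL) (r := quo_pi S)).
Qed.

Lemma projective_section U P (g : {linear U -> P}) :
  projective P -> (forall y, exists x, g x = y) ->
  exists s : {linear P -> U}, cancel s g.
Proof. by move=> pP g_surj; have [s sE] := pP _ _ g idfun g_surj; exists s. Qed.

Lemma quo_pi_eq0 V (S : submodClosed V) (x : V) :
  (quo_pi S x == 0) = (x \in (S : {pred V})).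
Proof.
rewrite -(linear0 (quo_pi S)) -[X in _ = (X \in _)]subr0.
by apply/eqP/idP => /quomod_eqP.
Qed.

Lemma quo_pi_surj V (S : submodClosed V) (y : quomod S) : exists x, quo_pi S x = y.
Proof. by exists (repr y); exact: reprK. Qed.

End Linear.

(** * Signs and changes of index *)

Lemma sign_mul (n : int) : (-1) ^ n * (-1) ^ n = 1 :> int.
Proof. by rewrite -exprzMl // mulrNN mul1r exp1rz. Qed.

Lemma signS (n : int) : (-1) ^ (n + 1) = - (-1) ^ n :> int.
Proof. by rewrite exprzDr // expr1z mulrN1. Qed.

Section Transport.
Variables (R : pzRingType) (C : int -> lmodType R).

(** Taking [f] over all indices lets the equation i = j be eliminated. Applied to differentials,
    this lemma moves the target of d along an equation of indices, and [fun_transport] moves its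
    source. *)
Lemma transport_fun (T : Type) (f : T -> forall i, C i) i j x :
  i = j -> transport C i j (f x i) = f x j.
Proof. by move=> <-; exact: transport_id. Qed.

Lemma fun_transport (T : Type) (f : forall i, C i -> T) i j x :
  i = j -> f j (transport C i j x) = f i x.
Proof. by move=> <-; rewrite transport_id. Qed.

Lemma transportK i j : i = j -> cancel (transport C i j) (transport C j i).
Proof. by move=> <- x; rewrite !transport_id. Qed.
End Transport.

(** * Complexes with zero differential *)

Section NullComplex.
Variables (R : pzRingType) (Q : lmodType R).

Definition null_complex : complex R.
Proof. by refine (@Complex R (fun _ => Q) (fun i j => \0) _ _). Defined.

Lemma transport_null i j x : i = j -> transport null_complex i j x = x.
Proof. by move=> <-; exact: transport_id. Qed.

Lemma CE_projective_null : projective Q -> CE_projective null_complex.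
Proof.
move=> pQ n; have pZ : projective (Zmod null_complex n).
  by apply: (projective_submod (r := idfun)) pQ => // x; rewrite !inE /=.
have B0 x : x \in Bpred null_complex n -> x = 0 by move=> /asboolP[y <-].
split=> //.
  by apply: projective_trivial => x; apply: val_inj; exact: B0 (valP x).
apply: projective_quomod pZ => x xB; apply: val_inj; exact: B0 xB.
Qed.
End NullComplex.

(** * Splittings of a C-E projective complex *)

Section Boundaries.
Variable R : pzRingType.
Implicit Types C P : complex R.

Lemma d_mem_B C i j x : d C i j x \in Bpred C j.
Proof.
apply/asboolP; have [ij|/d_shape ->] := eqVneq i (j + 1).
  by subst i; exists x.
by exists 0; exact: linear0.
Qed.

Lemma exact_complexP C i j k : exact_complex C -> i = j + 1 -> j = k + 1 ->
  exact_at (d C i j) (d C j k).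
Proof.
move=> exC -> jk; have -> : k = j - 1 by lia.
exact: exC.
Qed.

Lemma CE_section P i j : CE_projective P -> i = j + 1 ->
  exists s : {linear Bmod P j -> P i}, forall b, d P i j (s b) = val b.
Proof.
move=> ceP ->; have [_ _ pB _] := ceP j.
have [|s sK] := projective_section (g := corestrict (@d_mem_B P (j + 1) j)) pB.
  case=> y yB; have /asboolP[x xy] := yB.
  by exists x; apply: val_inj.
by exists s => b; rewrite -[in RHS](sK b).
Qed.

(** Two splittings are combined: x - s (d x) maps P_n to cycles, and z - t [z] maps cycles to
    boundaries, where t is a section of the projection from Z_n to H_n. Both corrections vanish on
    boundaries. *)
Lemma CE_retraction P n : CE_projective P ->
  exists r : {linear P n -> Bmod P n}, forall b : Bmod P n, r (val b) = b.
Proof.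
move=> ceP; have [s sE] := @CE_section P n (n - 1) ceP ltac:(lia).
have [_ _ _ pH] := ceP n.
have [t tK] := projective_section pH (@quo_pi_surj _ _ (BinZ P n)).
pose e : {linear P n -> Bmod P (n - 1)} := corestrict (@d_mem_B P n (n - 1)).
have zP x : (idfun \- (s \o e)) x \in Zpred P n.
  by rewrite !inE /= linearB sE subrr.
pose z : {linear P n -> Zmod P n} := corestrict zP.
have bP x : ((val : Zmod P n -> P n) \o (z \- (t \o (quo_pi (BinZ P n) \o z)))) x
    \in Bpred P n.
  rewrite -[_ \in _]/((z x - t (quo_pi (BinZ P n) (z x))) \in BinZ P n).
  by rewrite -quo_pi_eq0 linearB tK subrr.
exists (corestrict bP) => b; apply: val_inj => /=.
have eb : e (val b) = 0.
  by apply: val_inj; have /asboolP[x <-] := valP b; exact: dK.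
have zb : val (z (val b)) = val b.
  by rewrite -[LHS]/(val b - s (e (val b))) eb linear0 subr0.
have /eqP piz : quo_pi (BinZ P n) (z (val b)) == 0.
  by rewrite quo_pi_eq0 -[_ \in _]/(val (z (val b)) \in Bpred P n) zb; exact: valP b.
rewrite -[LHS]/(val (z (val b) - t (quo_pi (BinZ P n) (z (val b))))).
by rewrite piz linear0 subr0.
Qed.

(** These maps serve as a partial contraction of P in the homotopies below. *)
Lemma CE_splitting P i j : CE_projective P -> i = j + 1 ->
  exists s : {linear P j -> P i}, forall x, d P i j (s (d P i j x)) = d P i j x.
Proof.
move=> ceP ij.
have [s sE] := CE_section ceP ij; have [r rK] := CE_retraction j ceP.
exists (s \o r) => x; rewrite /= sE.
by rewrite -[d P i j x]/(val (Submod (d_mem_B j x) : Bmod P j)) rK.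
Qed.

Definition Zval C n : {linear Zmod C n -> C n} := (val : Zmod C n -> C n).

Lemma ZvalE C n (z : Zmod C n) : Zval C n z = submod_val z.
Proof. by []. Qed.

Lemma d_Zval C n k (z : Zmod C n) : d C n k (Zval C n z) = 0.
Proof.
have [nk|/d_shape -> //] := eqVneq n (k + 1).
have -> : k = n - 1 by lia.
by have := valP z; rewrite !inE => /eqP.
Qed.

End Boundaries.

(** * The factorization property and null-homotopies *)

Section Extension.
Variable R : pzRingType.
Implicit Types C G P : complex R.

(** For exact G, a map that vanishes on B_i(G) vanishes on the kernel of d, so it amounts to a map
    on B_j(G); the condition asks that this map extend to G_j. *)
Definition maps_extend_from_boundaries G : Prop :=
  forall i j (Q : lmodType R), i = j + 1 -> projective Q ->
  forall g : {linear G i -> Q}, (forall k x, g (d G k i x) = 0) ->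
  exists t : {linear G j -> Q}, forall x, t (d G i j x) = g x.

(* A map of degree N is given by all b t k : G_t -> P_k to avoid casts along k = t + N;
   the components with k <> t + N are junk. *)
Lemma maps_extend_nullhomotopy G P (N e : int) (b : forall t k, {linear G t -> P k}) :
  maps_extend_from_boundaries G -> CE_projective P -> e * e = 1 ->
  (forall t k x, k = t + N ->
     d P k (k - 1) (b t k x) = b (t - 1) (k - 1) (d G t (t - 1) x) *~ e) ->
  exists h : forall t k, {linear G t -> P k}, forall t k x, k = t + N ->
    b t k x = d P (k + 1) k (h t (k + 1) x) + h (t - 1) k (d G t (t - 1) x) *~ e.
Proof.
move=> extG ceP ee bd.
have sP (ij : int * int) : exists s : {linear P ij.2 -> P ij.1}, ij.1 = ij.2 + 1 ->
    forall x, d P ij.1 ij.2 (s (d P ij.1 ij.2 x)) = d P ij.1 ij.2 x.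
  case: (eqVneq ij.1 (ij.2 + 1)) => [/(CE_splitting ceP)[s sE]|/eqP ne].
    by exists s.
  by exists \0 => /ne.
pose s i j : {linear P j -> P i} := sval (cid (sP (i, j))).
have sE i j x : i = j + 1 -> d P i j (s i j (d P i j x)) = d P i j x.
  by move=> ij; exact: (svalP (cid (sP (i, j)))) ij x.
clearbody s => {sP}.
(* s is a homotopy from 1 to eta, whose image consists of cycles. *)
pose eta k := idfun \- (d P (k + 1) k \o s (k + 1) k) \- (s k (k - 1) \o d P k (k - 1)).
have etaZ k x : eta k x \in Zpred P k.
  by rewrite !inE /eta /= !linearB dK subr0 sE ?subrr //; lia.
have etad k x : eta k (d P (k + 1) k x) = 0.
  by rewrite /eta /= sE // dK linear0 subr0 subrr.
pose z k : {linear P k -> Zmod P k} := corestrict (etaZ k).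
have thP (tk : int * int) : exists th : {linear G tk.1 -> Zmod P tk.2},
    tk.2 = tk.1 + 1 + N ->
    forall x, th (d G (tk.1 + 1) tk.1 x) = z tk.2 (b (tk.1 + 1) tk.2 x).
  case: tk => t k /=; case: (eqVneq k (t + 1 + N)) => [kE|/eqP ne]; last first.
    by exists \0 => /ne.
  have [_ pZ _ _] := ceP k.
  (* [z k \o b] vanishes on boundaries, because b d = d b up to the sign [e] and [eta] kills
     boundaries. *)
  have [|th thE] := extG (t + 1) t _ erefl pZ (z k \o b (t + 1) k); last by exists th.
  move=> l x; apply: val_inj => /=.
  have [lE|/d_shape ->] := eqVneq l (t + 1 + 1); last by rewrite !linear0 !addr0.
  subst l; have := bd (t + 1 + 1) (k + 1) x ltac:(lia).
  rewrite !addrK => /(congr1 (fun y => y *~ e)).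
  by rewrite -mulrzA ee mulr1z -linearMz => <-; exact: etad.
pose th t k : {linear G t -> Zmod P k} := sval (cid (thP (t, k))).
have thE t k x : k = t + 1 + N -> th t k (d G (t + 1) t x) = z k (b (t + 1) k x).
  by move=> kE; exact: (svalP (cid (thP (t, k)))) kE x.
clearbody th => {thP}.
(* The term in [s] contributes d s b + s d b = b - [eta] b. The term in [th] supplies the missing
   [eta] b: its values are cycles, so only [th] d = [eta] b remains. *)
have hL t k : linear (fun x => s k (k - 1) (b t (k - 1) x) + Zval _ _ (th t k x) *~ e).
  move=> a x y; rewrite !linearP mulrzDl scalerDr scalerMzr.
  by rewrite !addrA; congr (_ + _); rewrite addrAC.
pose h t k := lin_of (hL t k).
have hE t k x : h t k x = s k (k - 1) (b t (k - 1) x) + Zval _ _ (th t k x) *~ e by [].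
exists h => t k x kE; rewrite !hE.
have := thE (t - 1) k; rewrite subrK => /(_ x kE) thb.
rewrite mulrzDl -mulrzA ee mulr1z thb linearD (linearMz (d P (k + 1) k)).
rewrite d_Zval mul0rz addr0 addrK.
rewrite -linearMz -bd // ZvalE /= /eta /=.
by rewrite addrA [RHS]addrC -[X in X + _]addrA -opprD subrK.
Qed.

(** A cycle of degree n commutes with the differentials up to (-1)^n, and a null-homotopy of it is a
    preimage under the differential of the Hom complex, since (-1)^(n+1) = -(-1)^n. *)
Lemma hom_complex_exact G P :
  maps_extend_from_boundaries G -> CE_projective P -> exact_complex (hom_complex G P).
Proof.
move=> extG ceP n f; split=> [df|[g <-]]; last exact: homdK.
pose e : int := (-1) ^ n.
have ee : e * e = 1 := sign_mul n.
pose b t k : {linear G t -> P k} := transport P (n + t) k \o (f t : {linear G t -> P (n + t)}).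
have [|h hE] := maps_extend_nullhomotopy (N := n) (b := b) extG ceP ee.
  move=> t k x; rewrite addrC => ->; rewrite /b /= transport_id.
  have := congr1 (fun F : homobj G P (n - 1) => (F t : {linear _ -> _}) x) df.
  rewrite /= /homd_fun => /eqP; rewrite subr_eq0.
  by have <- : n + t - 1 = n - 1 + t; [lia | move=> /eqP].
exists (fun m => h m (n + 1 + m)).
apply: functional_extensionality_dep => m; apply: Hom_ext => x.
have := hE m (n + m) x (addrC _ _); rewrite /b /= transport_id => ->.
rewrite /= /homd_fun signS mulrNz opprK -/e.
rewrite (transport_fun (fun y k => h (m - 1) k y)); last lia.
by have -> : n + m + 1 = n + 1 + m by lia.
Qed.

(** The test complex is Q in every degree with zero differential. The family equal to g in degree i
    and to 0 elsewhere is a cycle of degree 0, as g vanishes on boundaries. A preimage h satisfies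
    h_(i-1) d = g, because the sign in degree 1 is -1. *)
Lemma hom_complex_exact_extend G :
  (forall P, CE_projective P -> exact_complex (hom_complex G P)) ->
  maps_extend_from_boundaries G.
Proof.
move=> exG i j Q ij pQ g gd.
pose f : homobj G (null_complex Q) 0 := fun t => g \o transport G t i.
have /(_ f)[+ _] := exG _ (CE_projective_null pQ) 0.
case=> [|h fE].
  apply: functional_extensionality_dep => m; apply: Hom_ext => x.
  rewrite [LHS]/= /homd_fun /= sub0r.
  have -> : transport G (m - 1) i (d G m (m - 1) x) = d G m i x.
    have [mi|mi] := eqVneq (m - 1) i.
      by rewrite (transport_fun (fun y k => d G m k y)).
    by rewrite transport_neq // d_shape //; apply: contraNneq mi => ->; lia.
  by rewrite gd linear0 mul0rz oppr0.
have -> : j = i - 1 by lia.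
exists (h (i - 1)) => x.
have := congr1 (fun F : homobj G (null_complex Q) 0 => (F i : {linear _ -> _}) x) fE.
rewrite /= /homd_fun /= transport_id => <-.
by rewrite transport_null; [rewrite sub0r mulrNz opprK | lia].
Qed.

End Extension.

(** * Invariance under isomorphism *)

Section Isomorphism.
Variables (R : pzRingType) (G K : complex R) (f : chain G K) (g : chain K G).
Hypotheses (fK : forall n, cancel (f n) (g n)) (gK : forall n, cancel (g n) (f n)).

Lemma iso_exact : exact_complex G -> exact_complex K.
Proof.
move=> exG n y; split=> [dy|[x <-]]; last exact: dK.
have /(exG n)[x xE] : d G n (n - 1) (g n y) = 0 by rewrite -chainP [d _ _ _ _]dy linear0.
by exists (f (n + 1) x); rewrite -[LHS]/(d K _ _ _) -chainP [d _ _ _ _]xE gK.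
Qed.

Lemma iso_maps_extend : maps_extend_from_boundaries K -> maps_extend_from_boundaries G.
Proof.
move=> extK i j Q ij pQ u ud.
have [|t tE] := extK i j Q ij pQ (u \o g i).
  by move=> k x; rewrite /= chainP ud.
by exists (t \o f j) => x; rewrite /= chainP tE /= fK.
Qed.
End Isomorphism.

(** * Kernels in a resolution have the factorization property *)

Section Kernel.
Variables (R : pzRingType) (X : complex_seq R).

(** With s a section of a onto its image, 1 - s a is a projection onto the kernel. *)
Lemma split_ker_projective i n : split_map (arrow X i n) ->
  projective (X i n) -> projective (ker_complex (arrow X i) n).
Proof.
move=> [s sE]; set a := arrow X i n.
have imP x : a x \in im_pred a by apply/asboolP; exists x.
have rP x : (idfun \- (s \o corestrict imP)) x \in ker_pred a.
  by rewrite !inE /= linearB sE subrr.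
apply: (projective_submod (r := idfun \- (s \o corestrict imP))) rP _ => x.
rewrite inE => /eqP ax; rewrite /=.
have -> : Submod (imP x) = 0 by apply: val_inj.
by rewrite linear0 subr0.
Qed.

(* For g vanishing on the boundaries of the kernel K, the map g \o a (with a the
   arrow onto K) is pi \o d for some pi; subtracting from pi a chain map to a
   complex without differential makes it vanish on the kernel of a. *)
Lemma ker_maps_extend j :
  (forall n i, exact_at (arrow X i n) (arrow X (i + 1) n)) ->
  (forall n i, split_map (arrow X i n)) ->
  (forall i, CE_projective (X i)) ->
  (forall Q : complex R, CE_projective Q ->
    exact_at (precomp (Q := Q) (arrow X (j + 1))) (precomp (Q := Q) (arrow X j))) ->
  exact_complex (ker_complex (arrow X (j + 1 + 1 + 1))) ->
  maps_extend_from_boundaries (ker_complex (arrow X (j + 1 + 1 + 1))).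
Proof.
move=> exX splX ceX exHom exK i k Q ik pQ g gd.
set K := ker_complex _ in exK g gd *.
pose a := arrow X (j + 1 + 1).
have aK n x : a n x \in ker_pred (arrow X (j + 1 + 1 + 1) n).
  by rewrite inE; apply/eqP/exX; exists x.
pose b n : {linear X (j + 1 + 1) n -> K n} := corestrict (@aK n).
have bd m n x : b n (d (X (j + 1 + 1)) m n x) = d K m n (b m x).
  by apply: val_inj; rewrite /= chainP.
have aa n x : a n (arrow X (j + 1) n x) = 0 by apply/exX; exists x.
have [s sE] := CE_section (ceX (j + 1 + 1)) ik.
have [r rK] := CE_retraction k (ceX (j + 1 + 1)).
(* On d x this gives g (b (s (d x))), and s (d x) - x is a cycle, sent by b to a cycle of K. By
   exactness of K that is a boundary, so g kills it and [pi] d = g b. *)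
pose pi : {linear X (j + 1 + 1) k -> Q} := g \o b i \o s \o r.
have piE x : pi (d (X (j + 1 + 1)) i k x) = g (b i x).
  pose y : Bmod (X (j + 1 + 1)) k := Submod (d_mem_B k x).
  have -> : pi (d (X (j + 1 + 1)) i k x) = g (b i (s y)) by rewrite -(rK y).
  apply/eqP; rewrite -subr_eq0 -!linearB; apply/eqP.
  have [|w <-] := (exact_complexP exK (erefl (i + 1)) ik (b i (s y - x))).1.
    by rewrite -bd linearB sE subrr linear0.
  exact: gd.
(* [phi] is [pi] after the arrow in degree k and 0 elsewhere. It kills boundaries since [pi] d = g b
   and b kills the image of that arrow, so it is a chain map to [null_complex Q]. *)
pose phi t : {linear X (j + 1) t -> Q} :=
  pi \o arrow X (j + 1) k \o transport (X (j + 1)) t k.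
have phiE t x : phi t x = pi (arrow X (j + 1) k (transport (X (j + 1)) t k x)) by [].
have phiP : (phi : dprod (fun t => Defs.Hom (X (j + 1) t) (null_complex Q t)))
    \in chain_pred (X (j + 1)) (null_complex Q).
  apply/asboolP => m n x; rewrite [RHS]/= -[LHS]/(phi n (d (X (j + 1)) m n x)) phiE.
  have [nk|/transport_neq ->] := eqVneq n k; last by rewrite !linear0.
  subst n; rewrite transport_id chainP.
  have [mi|mi] := eqVneq m i; last by rewrite d_shape ?linear0 // -ik.
  subst m; rewrite piE.
  have -> : b i (arrow X (j + 1) i x) = 0 by apply: val_inj; exact: aa.
  exact: linear0.
have /(_ (Chain phiP))[+ _] := exHom _ (CE_projective_null pQ).
case=> [|e eE].
  apply: val_inj; apply: functional_extensionality_dep => t; apply: Hom_ext => x.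
  rewrite [RHS]/= -[LHS]/(phi t (arrow X j t x)) phiE.
  have [tk|/transport_neq ->] := eqVneq t k; last by rewrite !linear0.
  subst t; rewrite transport_id.
  have -> : arrow X (j + 1) k (arrow X j k x) = 0 by apply/exX; exists x.
  exact: linear0.
have {}eE x : e k (arrow X (j + 1) k x) = pi (arrow X (j + 1) k x).
  have := congr1 (fun F : chain _ _ => F k x) eE.
  by move=> exE; rewrite [LHS]exE -[LHS]/(phi k x) phiE transport_id.
have ed x : e k (d (X (j + 1 + 1)) i k x) = 0 by rewrite chainP.
have [t tE] := splX k (j + 1 + 1).
have cP (y : K k) : submod_val y \in im_pred (a k).
  by have := valP y; rewrite inE => /eqP/exX yE; apply/asboolP.
pose c : {linear K k -> submod (im_pred (a k))} := corestrict (f := (val : K k -> _)) cP.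
(* [pi \- e k] vanishes on the kernel of a, so its composite with the section t does not depend on
   the lift. On b (d x) it gives [pi] (d x) = g (b x), as e is a chain map to a complex with zero
   differential and so kills d x. *)
exists ((pi \- e k) \o t \o c) => y.
have [x xy] : exists x, b i x = y.
  have := valP y; rewrite inE => /eqP/exX[x xE].
  by exists x; apply: val_inj.
rewrite -xy -bd; set z := d _ _ _ x.
rewrite -[LHS]/(pi (t (c (b k z))) - e k (t (c (b k z)))).
have /exX[w wE] : a k (t (c (b k z)) - z) = 0.
  by rewrite linearB tE /= subrr.
have -> : t (c (b k z)) = z + arrow X (j + 1) k w by rewrite wE subrKC.
by rewrite (linearD pi) (linearD (e k)) eE opprD addrACA subrr addr0 piE ed subr0.
Qed.
End Kernel.

Lemma strongly_CE_Gorenstein_maps_extend (R : pzRingType) (G : complex R) :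
  exact_complex G -> strongly_CE_Gorenstein_projective G ->
  (forall n, projective (G n)) /\ maps_extend_from_boundaries G.
Proof.
move=> exG [X [[exX splX] ceX [f [g fgK]] exHom]].
have fK n := (fgK n).1; have gK n := (fgK n).2.
split=> [n|].
  apply: (projective_retract (fK n)); apply: split_ker_projective => //.
  by have [] := ceX 0 n.
apply: (iso_maps_extend fK).
(* [ker_maps_extend] starts three terms before the kernel, so index 0 is rewritten in the form that
   it expects. *)
have extK l : l = -3 + 1 + 1 + 1 -> exact_complex (ker_complex (arrow X l)) ->
    maps_extend_from_boundaries (ker_complex (arrow X l)).
  move=> ->; apply: ker_maps_extend => //.
    by move=> n i; have [ex _ _ _] := exX n; exact: ex.
  by move=> Q ceQ; exact: exHom.
by apply: extK => //; exact: iso_exact gK exG.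
Qed.

(** * A resolution of G by contractible complexes *)

Section DiscSequence.
Variables (R : pzRingType) (G : complex R).

(* [disc i] is the i-th shift of cone(1_G), in coordinates in which its differential
   is (x, y) |-> (y, 0); the sign (-1)^n makes [disc_arrow_fun] a chain map. *)

Definition disc_obj (i n : int) : lmodType R := (G (n - i) * G (n - (i + 1)))%type.

Definition disc_fun i m n (z : disc_obj i m) : disc_obj i n :=
  (transport G (m - (i + 1)) (n - i) z.2, 0).

Fact disc_linear i m n : linear (@disc_fun i m n).
Proof. by move=> a x y; rewrite /disc_fun /= linearP; congr (_, _); rewrite /= scaler0 addr0. Qed.

Definition disc (i : int) : complex R.
Proof.
refine (@Complex R (disc_obj i) (fun m n => lin_of (@disc_linear i m n)) _ _).
- move=> m n x mn; rewrite /= /disc_fun transport_neq //.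
  by apply: contraNneq mn; lia.
- by move=> m n k x; rewrite /= /disc_fun /= linear0.
Defined.

(** Up to sign, this is (x, y) |-> y - d x onto a shift of G, followed by the inclusion v |-> (v, d
    v); note d (y - d x) = d y. *)
Definition disc_arrow_fun i n (z : disc i n) : disc (i + 1) n :=
  ((z.2 - d G (n - i) (n - (i + 1)) z.1) *~ (-1) ^ n,
   d G (n - (i + 1)) (n - (i + 1 + 1)) z.2 *~ (-1) ^ n).

Fact disc_arrow_linear i n : linear (@disc_arrow_fun i n).
Proof.
move=> a x y; congr (_, _); rewrite /= !linearP; last by rewrite mulrzDl scalerMzr.
by rewrite addrACA -scalerDr mulrzDl scalerMzr.
Qed.

Definition disc_arrow_lin i n : {linear disc i n -> disc (i + 1) n} :=
  lin_of (@disc_arrow_linear i n).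

Fact disc_arrow_chain i :
  (@disc_arrow_lin i : dprod (fun n => Defs.Hom (disc i n) (disc (i + 1) n)))
  \in chain_pred (disc i) (disc (i + 1)).
Proof.
apply/asboolP => m n z.
have [mn|mn] := eqVneq m (n + 1); last by rewrite !d_shape // linear0.
subst m; rewrite /= /disc_arrow_fun /disc_fun /=; congr (_, _); last first.
  by rewrite linear0 mul0rz.
rewrite linearMz signS mulrNz sub0r mulNrz; congr (- (_ *~ _)).
by rewrite (transport_fun (fun y k => d G _ k y)) ?(fun_transport (fun k y => d G k _ y)) //; lia.
Qed.

Definition disc_seq : complex_seq R :=
  ComplexSeq (fun i => Chain (disc_arrow_chain i) : chain (disc i) (disc (i + 1))).

Lemma disc_arrowE i n (z : disc i n) : arrow disc_seq i n z = disc_arrow_fun z.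
Proof. by []. Qed.

Lemma signK (V : zmodType) (n : int) (x : V) : x *~ (-1) ^ n *~ (-1) ^ n = x.
Proof. by rewrite -mulrzA sign_mul. Qed.

Lemma disc_arrow_arrow i n (z : disc i n) :
  arrow disc_seq (i + 1) n (arrow disc_seq i n z) = 0.
Proof.
rewrite !disc_arrowE /disc_arrow_fun /=; congr (_, _).
  by rewrite linearMz linearB dK subr0 subrr mul0rz.
by rewrite linearMz dK !mul0rz.
Qed.

Lemma disc_Z i n (z : disc i n) : (z \in Zpred (disc i) n) = (z.2 == 0).
Proof.
rewrite !inE /= /disc_fun; apply/eqP/eqP => [[/(congr1 (transport G _ (n - (i + 1))))]|->].
  by rewrite transportK ?linear0 //; lia.
by rewrite linear0.
Qed.

Lemma disc_B i n (z : disc i n) : (z \in Bpred (disc i) n) = (z.2 == 0).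
Proof.
apply/asboolP/eqP => [[x <-] //|z0].
exists (0, transport G (n - i) (n + 1 - (i + 1)) z.1).
rewrite /= /disc_fun /= transportK; last lia.
by rewrite [RHS]surjective_pairing z0.
Qed.

Lemma disc_H i n (x : Hmod (disc i) n) : x = 0.
Proof.
have [y <-] := quo_pi_surj x; apply/eqP; rewrite quo_pi_eq0.
rewrite -[_ \in _]/(submod_val y \in Bpred (disc i) n) disc_B -disc_Z.
exact: valP y.
Qed.

Lemma disc_CE_projective i : (forall n, projective (G n)) -> CE_projective (disc i).
Proof.
move=> pG n; have pD : projective (disc i n) by exact: projective_prod.
have rL : linear (fun z : disc i n => (z.1, 0) : disc i n).
  by move=> a x y; congr (_, _); rewrite /= scaler0 addr0.
have rK (z : disc i n) : z.2 == 0 -> (z.1, 0) = z by case: z => x y /= /eqP ->.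
split=> //.
- apply: (projective_submod (r := lin_of rL)) pD => x; rewrite disc_Z //=; exact: rK.
- apply: (projective_submod (r := lin_of rL)) pD => x; rewrite disc_B //=; exact: rK.
- by apply: projective_trivial; exact: disc_H.
Qed.

Lemma disc_exact i n : exact_at (arrow disc_seq i n) (arrow disc_seq (i + 1) n).
Proof.
move=> z; split=> [|[x <-]]; last exact: disc_arrow_arrow.
rewrite disc_arrowE => -[/(congr1 (fun y => y *~ (-1) ^ n)) + _].
rewrite signK mul0rz => /eqP; rewrite subr_eq0 => /eqP zE.
(* A kernel element has the form (x, d x), which is up to sign the image of (0, x). *)
exists (0, z.1 *~ (-1) ^ n); rewrite disc_arrowE /disc_arrow_fun /= linear0 subr0.
by rewrite linearMz !signK -zE -surjective_pairing.
Qed.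

(** * Exactness on cycles, boundaries and quotients *)

Section InducedExactness.
Hypothesis exG : exact_complex G.
Variables (i n : int).
Variables (S0 : submodClosed (disc i n)) (S1 : submodClosed (disc (i + 1) n)).
Variable S2 : submodClosed (disc (i + 1 + 1) n).
Hypotheses (S0E : forall z : disc i n, (z \in (S0 : {pred _})) = (z.2 == 0))
  (S1E : forall z : disc (i + 1) n, (z \in (S1 : {pred _})) = (z.2 == 0))
  (S2E : forall z : disc (i + 1 + 1) n, (z \in (S2 : {pred _})) = (z.2 == 0)).
Hypotheses
  (S01 : forall z, z \in (S0 : {pred _}) -> arrow disc_seq i n z \in (S1 : {pred _}))
  (S12 : forall z, z \in (S1 : {pred _}) -> arrow disc_seq (i + 1) n z \in (S2 : {pred _})).

(** The submodules stand for the cycles or for the boundaries, both equal to the first factor. There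
    the arrow is d up to sign, so exactness is that of G. *)
Lemma disc_sub_exact : exact_at (Defs.sub_map S01) (Defs.sub_map S12).
Proof.
move=> z; split=> [/(congr1 val) zE|[x <-]]; last first.
  by apply: val_inj; exact: disc_arrow_arrow.
have {zE} : arrow disc_seq (i + 1) n (val z) = 0 := zE.
rewrite disc_arrowE => -[/(congr1 (fun y => y *~ (-1) ^ n)) + _].
have := valP z; rewrite S1E => /eqP z2.
rewrite z2 signK mul0rz sub0r => /eqP; rewrite oppr_eq0 => /eqP.
have /exact_complexP ex := exG => /(ex (n - i)); case; try lia.
move=> w wE.
have wS : (- w *~ (-1) ^ n, 0) \in (S0 : {pred disc i n}) by rewrite S0E.
exists (Submod wS); apply: val_inj.
rewrite -[LHS]/(arrow disc_seq i n (- w *~ (-1) ^ n, 0)) disc_arrowE /disc_arrow_fun /=.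
rewrite sub0r linearMz linearN wE !mulNrz opprK signK linear0 mul0rz.
by rewrite [RHS]surjective_pairing z2.
Qed.

(** Modulo the first factor, the arrow is again d up to sign, now on second coordinates. *)
Lemma disc_quo_exact : exact_at (Defs.quo_map S01) (Defs.quo_map S12).
Proof.
move=> y; have [z <-] := quo_pi_surj y; split=> [|[x <-]]; last first.
  have [{}z <-] := quo_pi_surj x.
  by rewrite !quo_mapE disc_arrow_arrow linear0.
rewrite quo_mapE => /eqP; rewrite quo_pi_eq0 S2E disc_arrowE /= => /eqP.
move=> /(congr1 (fun y => y *~ (-1) ^ n)); rewrite signK mul0rz.
have /exact_complexP ex := exG => /(ex (n - (i + 1))); case; try lia.
move=> w wE; pose u : disc i n := (0, w *~ (-1) ^ n); exists (quo_pi S0 u).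
apply: etrans (quo_mapE S01 u) _.
apply/quomod_eqP; rewrite S1E disc_arrowE /=.
by rewrite linearMz signK wE subrr.
Qed.
End InducedExactness.

Lemma disc_CE_exact : exact_complex G -> strongly_CE_exact disc_seq.
Proof.
move=> exG; split=> [n|n i].
  split=> [i||| ]; first exact: disc_exact.
  - by move=> i; apply: disc_sub_exact => // z; exact: disc_Z.
  - by move=> i; apply: disc_sub_exact => // z; exact: disc_B.
  split=> [i|i|i y].
  - by apply: disc_quo_exact => // z; exact: disc_Z.
  - by apply: disc_quo_exact => // z; exact: disc_B.
  - by split=> _; [exists 0|]; rewrite [LHS]disc_H ?[RHS]disc_H.
(* The image consists of the pairs (v, d v), and (v, d v) lifts to (0, v) up to sign. *)
have sL : linear (fun y : submod (im_pred (arrow disc_seq i n)) =>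
    (0, (val y).1 *~ (-1) ^ n) : disc i n).
  move=> a x y; congr (_, _); first by rewrite /= scaler0 addr0.
  by rewrite /= mulrzDl scalerMzr.
exists (lin_of sL) => y; have /asboolP[x xE] := valP y.
rewrite disc_arrowE /disc_arrow_fun /= linear0 subr0 linearMz !signK.
rewrite [RHS]surjective_pairing -[submod_val y]xE; congr (_, _).
by rewrite /= linearMz linearB dK subr0.
Qed.

Lemma disc_kernel_iso : iso_complex G (ker_complex (arrow disc_seq 0)).
Proof.
have n0 (n : int) : n = n - 0 by lia.
(* The kernel of the arrow is the graph of d; the first coordinate is the inverse isomorphism. *)
pose f n (x : G n) : disc 0 n := (transport G n (n - 0) x, d G n (n - (0 + 1)) x).
have fL n : linear (@f n) by move=> a x y; rewrite /f !linearP.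
have fK n x : lin_of (fL n) x \in ker_pred (arrow disc_seq 0 n).
  rewrite inE disc_arrowE /disc_arrow_fun /= dK mul0rz.
  by rewrite (fun_transport (fun k y => d G k (n - (0 + 1)) y)) // subrr mul0rz.
have fP : ((fun n => corestrict (@fK n)) :
    dprod (fun n => Defs.Hom (G n) (ker_complex (arrow disc_seq 0) n)))
    \in chain_pred G (ker_complex (arrow disc_seq 0)).
  apply/asboolP => m n x; apply: val_inj; rewrite /= /f /disc_fun /= dK; congr (_, _).
  have [mn|mn] := eqVneq m (n + 1).
    rewrite (transport_fun (fun y k => d G m k y)) // (transport_fun (fun y k => d G m k y)) //.
    by lia.
  by rewrite d_shape // linear0 transport_neq //; apply: contraNneq mn; lia.
have gL n : linear (fun z : ker_complex (arrow disc_seq 0) n =>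
    transport G (n - 0) n (submod_val z).1).
  by move=> a x y; rewrite -linearP.
have kerE n (z : ker_complex (arrow disc_seq 0) n) :
    (submod_val z).2 = d G (n - 0) (n - (0 + 1)) (submod_val z).1.
  have := valP z; rewrite inE disc_arrowE => /eqP[/(congr1 (fun y => y *~ (-1) ^ n)) + _].
  by rewrite signK mul0rz => /eqP; rewrite subr_eq0 => /eqP.
have gP : ((fun n => lin_of (@gL n)) :
    dprod (fun n => Defs.Hom (ker_complex (arrow disc_seq 0) n) (G n)))
    \in chain_pred (ker_complex (arrow disc_seq 0)) G.
  apply/asboolP => m n z; rewrite /= /disc_fun /= kerE.
  rewrite (fun_transport (fun k y => d G k n y)); last lia.
  have [mn|mn] := eqVneq m (n + 1).
    rewrite [transport G (m - (0 + 1)) _ _](transport_fun (fun y k => d G (m - 0) k y)).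
      by rewrite (transport_fun (fun y k => d G (m - 0) k y)).
    by lia.
  by rewrite [transport G (m - (0 + 1)) _ _]transport_neq ?linear0 ?d_shape //;
    apply: contraNneq mn; lia.
exists (Chain fP), (Chain gP) => n; split=> [x|z].
  by rewrite /= transportK.
apply: val_inj; rewrite /= /f transportK //.
rewrite (fun_transport (fun k y => d G k (n - (0 + 1)) y)) //.
by rewrite -kerE -surjective_pairing.
Qed.

(** A chain map y that kills the previous arrow factors through a shift of G by a map B of degree N.
    A null-homotopy of B yields the required factorization of y through the next arrow. *)
Lemma disc_hom_exact (Q : complex R) i :
  maps_extend_from_boundaries G -> CE_projective Q ->
  exact_at (precomp (Q := Q) (arrow disc_seq (i + 1))) (precomp (Q := Q) (arrow disc_seq i)).
Proof.
move=> extG ceQ y; split=> [yE|[h <-]]; last first.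
  apply: val_inj; apply: functional_extensionality_dep => n; apply: Hom_ext => z.
  by rewrite -[LHS]/(h n (arrow disc_seq (i + 1) n (arrow disc_seq i n z)))
    disc_arrow_arrow linear0.
have {}yE n z : y n (arrow disc_seq i n z) = 0.
  exact: (congr1 (fun F : chain (disc i) Q => F n z) yE).
pose N := i + 1 + 1.
have inL n : linear (fun v : G (n - N) => (0, v) : disc (i + 1) n).
  by move=> a u v; congr (_, _); rewrite /= scaler0 addr0.
pose B n : {linear G (n - N) -> Q n} := y n \o lin_of (@inL n).
have BE n v : B n v = y n ((0, v) : disc (i + 1) n) by [].
(* The pairs (x, d x) are images of the previous arrow, hence killed by y; subtracting one clears
   the first coordinate. *)
have yB n (z : disc (i + 1) n) : y n z = B n (z.2 - d G _ _ z.1).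
  have := yE n (0, z.1 *~ (-1) ^ n).
  rewrite disc_arrowE /disc_arrow_fun /= linear0 subr0 linearMz !signK => yz.
  rewrite -[LHS]subr0 -{}[in LHS]yz -linearB /B /=; congr (y n _).
  rewrite [z in LHS]surjective_pairing; congr (_, _); exact: subrr.
clearbody B.
have Bd m n v : m = n + 1 ->
    d Q m n (B m v) = - B n (d G (m - N) (n - N) v).
  move=> mn; rewrite [B m v]BE -chainP yB /= sub0r linearN; congr (- (B n _)).
  by rewrite (fun_transport (fun k z => d G k (n - N) z)) // /N; lia.
pose b t k : {linear G t -> Q k} := B k \o transport G t (k - N).
(* The sign is -1 for every N: the differential of (0, v) is (v, 0), on which y takes the value -B
   (d v). *)
have [//|t k x kE|h hE] := maps_extend_nullhomotopy (N := N) (e := -1) (b := b) extG ceQ.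
  rewrite /b /= Bd; last lia.
  rewrite (fun_transport (fun l z => d G l (k - 1 - N) z)); last lia.
  by rewrite (transport_fun (fun z l => d G t l z)) ?mulrN1z; last lia.
(* On a pair (w, d w) this is (-1)^n (d h w - h d w) = (-1)^n B w, and (-1)^n cancels the sign in
   the arrow. The alternation of that sign also makes the family a chain map. *)
have HL n : linear (fun z : disc (i + 1 + 1) n =>
    d Q (n + 1) n (h (n - N) (n + 1) z.1) *~ (-1) ^ n - h (n - (N + 1)) n z.2 *~ (-1) ^ n).
  move=> a u v; rewrite /= !linearP !mulrzDl [X in _ + X = _]opprD [LHS]addrACA.
  by rewrite scalerBr !scalerMzr.
pose H n : {linear disc (i + 1 + 1) n -> Q n} := lin_of (@HL n).
have HP : (H : dprod (fun n => Defs.Hom (disc (i + 1 + 1) n) (Q n)))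
    \in chain_pred (disc (i + 1 + 1)) Q.
  apply/asboolP => m n z.
  have [mn|mn] := eqVneq m (n + 1); last by rewrite !d_shape // linear0.
  subst m; rewrite /= linear0 mul0rz subr0 linearB !(linearMz (d Q _ _)) dK mul0rz sub0r.
  rewrite signS mulrNz opprK; congr (_ *~ _).
  by rewrite (fun_transport (fun k y => d Q (n + 1) n (h k (n + 1) y))) // /N; lia.
exists (Chain HP).
apply: val_inj; apply: functional_extensionality_dep => n; apply: Hom_ext => z.
rewrite -[LHS]/(H n (arrow disc_seq (i + 1) n z)) -[RHS]/(y n z) yB disc_arrowE.
have := hE (n - N) n (z.2 - d G _ _ z.1); rewrite subrK => /(_ erefl).
rewrite /b /= transport_id => ->.
rewrite !linearMz !signK mulrN1z (linearB (d G (n - N) (n - N - 1))) dK subr0.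
by have -> : n - N - 1 = n - (N + 1) by lia.
Qed.

End DiscSequence.

Theorem proposition1p4 (R : pzRingType) (G : complex R) (hG : exact_complex G) :
  strongly_CE_Gorenstein_projective G <->
  ((forall n : int, projective (G n)) /\
   (forall P : complex R, CE_projective P -> exact_complex (hom_complex G P))).
Proof.
split=> [/(strongly_CE_Gorenstein_maps_extend hG)[pG extG]|[pG homG]].
  by split=> // P; exact: hom_complex_exact.
exists (disc_seq G); split.
- exact: disc_CE_exact.
- by move=> i; exact: disc_CE_projective.
- exact: disc_kernel_iso.
- by move=> Q ceQ i; apply: disc_hom_exact => //; exact: hom_complex_exact_extend.
Qed.
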